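(* Let $a$ and $b$ be positive integers with $a \leq b$. Then: (i) if $a < b/2$, then $\mathrm{ssp}(K_{a,b}) = b$; (ii) if $a \geq b/2$, then $\mathrm{ssp}(K_{a,b}) \geq \left(\sqrt{6(b/a)+4}-2\right)a$.
   Context: $K_{a,b}$ denotes the complete bipartite graph with parts of sizes $a$ and $b$. Given a collection $\mathcal{P}$ of paths in a graph $G$, two edges $e,f$ of $G$ are separated by $\mathcal{P}$ if there are paths $P_e,P_f\in\mathcal{P}$ such that $P_e$ contains $e$ but not $f$, and $P_f$ contains $f$ but not $e$. $\mathcal{P}$ is a strongly separating path system of $G$ if it separates every pair of distinct edges of $G$. $\mathrm{ssp}(G)$ denotes the minimum size of a strongly separating path system of $G$.
   Formalization: In part (ii) the case a = b = 1 is excluded, because K_{1,1} has a single edge, so ssp(K_{1,1}) = 0, which is less than √10 − 2, and the stated bound fails there. *)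

(* Defs.v *)
From mathcomp Require Import all_boot all_order all_algebra.

Set Implicit Arguments.
Unset Strict Implicit.
Unset Printing Implicit Defensive.

Local Open Scope nat_scope.

Record sgraph := SGraph {
  vertex :> finType;
  adj : rel vertex;
  adj_sym : symmetric adj;
  adj_irrefl : irreflexive adj
}.

Section Paths.

Variable G : sgraph.

Definition edges : {set {set G}} :=
  [set [set u.1; u.2] | u : G * G & adj u.1 u.2].

(* A subgraph is a pair (vertex set, edge set). *)
Definition subgraph : finType := ({set G} * {set {set G}})%type.

Definition verts (H : subgraph) : {set G} := H.1.
Definition edgs (H : subgraph) : {set {set G}} := H.2.

Definition seq_subgraph (p : seq G) : subgraph :=
  ([set x in p], [set [set u.1; u.2] | u in zip p (behead p)]).

(* Paths are subgraphs rather than vertex sequences, so that a sequence and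
   its reversal are the same path.  A path has at least one vertex and no
   repeated vertex, hence at most #|G| vertices. *)
Definition is_path (H : subgraph) : bool :=
  [exists k : 'I_#|G|, exists p : k.+1.-tuple G,
    [&& uniq p, sorted (@adj G) p & H == seq_subgraph p]].

Definition separates (P : {set subgraph}) (e f : {set G}) : bool :=
  [exists H in P, (e \in edgs H) && (f \notin edgs H)] &&
  [exists H in P, (f \in edgs H) && (e \notin edgs H)].

Definition strongly_separating (P : {set subgraph}) : bool :=
  [forall H in P, is_path H] &&
  [forall e in edges, forall f in edges, (e != f) ==> separates P e f].

Lemma is_pathP (H : subgraph) :
  reflect (exists2 p : seq G,
             [/\ p != [::], uniq p & sorted (@adj G) p] & H = seq_subgraph p)
          (is_path H).
Proof.
apply: (iffP existsP) => [[k /existsP[p /and3P[Up Sp /eqP->]]] | [p [p0 Up Sp] ->]].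
  by exists p => //; split=> //; rewrite -size_eq0 size_tuple.
have sp : (size p).-1.+1 = size p by rewrite prednK // lt0n size_eq0.
have lt_p : (size p).-1 < #|G| by rewrite sp -(card_uniqP Up) max_card.
have sz : size p == (Ordinal lt_p).+1 by rewrite /= sp.
exists (Ordinal lt_p); apply/existsP; exists (Tuple sz).
by rewrite /= Up Sp eqxx.
Qed.

Lemma all_paths_strongly_separating :
  strongly_separating [set H | is_path H].
Proof.
apply/andP; split; first by apply/forall_inP=> H; rewrite inE.
have sep1 e f : e \in edges -> f != e ->
    [exists H in [set H | is_path H], (e \in edgs H) && (f \notin edgs H)].
  case/imsetP=> -[x y]; rewrite inE /= => xy -> fe.
  apply/exists_inP; exists (seq_subgraph [:: x; y]).
    rewrite inE; apply/is_pathP; exists [:: x; y] => //; split=> //=.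
      by rewrite inE andbT; apply: contraTneq xy => ->; rewrite adj_irrefl.
    by rewrite xy.
  apply/andP; split; first by apply/imsetP; exists (x, y); rewrite ?inE.
  by apply: contraNN fe => /imsetP[u]; rewrite inE => /eqP-> /= ->.
apply/forall_inP=> e He; apply/forall_inP=> f Hf; apply/implyP=> ef.
by rewrite /separates !sep1 // eq_sym.
Qed.

Lemma strongly_separating_exists :
  exists n, [exists P : {set subgraph}, strongly_separating P && (#|P| == n)].
Proof.
exists #|[set H | is_path H]|; apply/existsP; exists [set H | is_path H].
by rewrite all_paths_strongly_separating eqxx.
Qed.

Definition ssp : nat := ex_minn strongly_separating_exists.

End Paths.

Definition biclique_adj (a b : nat) : rel ('I_a + 'I_b)%type :=
  fun u v => match u, v with
             | inl _, inr _ | inr _, inl _ => true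
             | _, _ => false
             end.

Lemma biclique_sym a b : symmetric (@biclique_adj a b).
Proof. by case=> ? []. Qed.

Lemma biclique_irrefl a b : irreflexive (@biclique_adj a b).
Proof. by case. Qed.

Definition biclique (a b : nat) : sgraph :=
  SGraph (@biclique_sym a b) (@biclique_irrefl a b).

(* Main.v *)
(* Let P be a strongly separating path system.  An edge lying on a single path
   of P is the only edge of that path, distinct edges lying on exactly two paths
   determine distinct pairs of paths, and the remaining edges lie on at least
   three paths.  Paths of K_{a,b} have at most 2a edges, so counting incidences
   between edges and paths gives |P| >= b and 6ab <= |P|^2 + 4a|P|.
   If 2a < b then b paths suffice: write the parts as {0, ..., a-1} and Z/b and
   let c_0, c_1, c_2, ... be 0, 1, -1, 2, -2, ...; the i-th path is
   i + c_0, 0, i + c_1, 1, ..., a-1, i + c_a.  The edge between j and k lies on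
   exactly the paths k - c_j and k - c_{j+1}, and this pair determines (j, k)
   because the differences c_{j+1} - c_j = (-1)^j (j+1) with j < a are distinct,
   even up to sign, modulo b. *)
Require Import Defs.
From mathcomp Require Import all_boot all_order all_algebra.
From mathcomp Require Import zify ring.

Set Implicit Arguments.
Unset Strict Implicit.
Unset Printing Implicit Defensive.

Import Order.TTheory GRing.Theory Num.Theory.

(* [t] counts the members of [P] containing an element that lies in no other
   member; such a member has no further element. *)
Lemma separating_family_count (T U : finType) (E : {set T}) (P : {set U})
    (S : U -> {set T}) (k : nat) :
    1 < #|E| ->
    {in P, forall H, S H \subset E} -> {in P, forall H, #|S H| <= k} ->
    {in E &, forall e f, e != f ->
       exists2 H, H \in P & (e \in S H) && (f \notin S H)} ->
  exists t m, [/\ #|P| = t + m, 2 * #|E| <= k * m + 2 * t &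
                  6 * #|E| <= 2 * k * m + m ^ 2 + 6 * t].
Proof.
move=> E_gt1 SE Sk sepE.
pose cov e := [set H in P | e \in S H].
(* The sets [cov e] form an antichain: a member separating [e] from [f] belongs to [cov e] but not
   to [cov f]. *)
have cov_sub e f : e \in E -> f \in E -> cov e \subset cov f -> e = f.
  move=> eE fE /subsetP sub; apply/eqP; apply: contraT => /(sepE _ _ eE fE).
  case=> H HP /andP[eH fH]; have := sub H.
  by rewrite !inE HP eH (negbTE fH) => /(_ isT).
have cov_inj : {in E &, injective cov}.
  by move=> e f eE fE ef; apply: cov_sub; rewrite ?ef.
(* An empty [cov e] would be included in every [cov f], leaving [e] as the only element of [E]; this
   contradicts [E_gt1]. *)
have cov_gt0 e : e \in E -> 0 < #|cov e|.
  move=> eE; rewrite card_gt0; apply: contraTneq E_gt1 => cov0.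
  rewrite -leqNgt -(cards1 e) subset_leq_card //; apply/subsetP => f fE.
  by rewrite inE eq_sym; apply/eqP/cov_sub; rewrite // cov0 sub0set.
(* [F] collects the members that are the sole cover of some element; by the antichain property such
   a member contains no other element. *)
pose F := [set H in P | [set H] \in cov @: E].
have FP : F \subset P by apply/subsetP => H; rewrite inE => /andP[].
have coverF H e : H \in F -> e \in S H -> e \in E /\ cov e = [set H].
  rewrite inE => /andP[HP /imsetP[e0 e0E covH]] eH.
  have eE : e \in E by apply: subsetP eH; apply: SE.
  suff <- : e0 = e by [].
  by apply: cov_sub => //; rewrite -covH sub1set inE HP.
pose E1 := [set e in E | #|cov e| == 1].
pose E2 := [set e in E | #|cov e| == 2].
have card1 : #|E1| = #|F|.
  rewrite -(card_in_imset (f := cov)); last first.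
    by move=> e f; rewrite !inE => /andP[eE _] /andP[fE _]; apply: cov_inj.
  rewrite -(card_imset _ (@set1_inj U)); apply: eq_card => A.
  apply/imsetP/imsetP => [[e]|[H]].
    rewrite inE => /andP[eE /cards1P[H eH]] ->; exists H => //.
    have: H \in cov e by rewrite eH set11.
    by rewrite !inE -eH imset_f // => /andP[->].
  rewrite inE => /andP[HP /imsetP[e eE eH]] ->; exists e => //.
  by rewrite inE eE -eH cards1 /=.
(* An element covered twice lies in no member of [F], so its cover is a pair from [P :\: F], and
   distinct elements give distinct pairs. *)
have card2 : 2 * #|E2| <= #|P :\: F| ^ 2.
  have: #|E2| <= 'C(#|P :\: F|, 2).
    rewrite -cards_draws -(card_in_imset (f := cov)); last first.
      by move=> e f; rewrite !inE => /andP[eE _] /andP[fE _]; apply: cov_inj.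
    apply/subset_leq_card/subsetP => _ /imsetP[e + ->].
    rewrite !inE => /andP[eE /eqP c2]; rewrite c2 eqxx andbT.
    apply/subsetP => H; rewrite inE => /andP[HP eH]; rewrite inE HP andbT.
    by apply: contra_eqN c2 => /coverF/(_ eH)[_ ->]; rewrite cards1.
  have := bin2 #|P :\: F|.
  have := half_leq (leqnn (#|P :\: F| * #|P :\: F|.-1)).
  rewrite -mulnn; nia.
have dcount : \sum_(e in E) #|cov e| = \sum_(H in P) #|S H|.
  under eq_bigr do rewrite -sum1_card.
  under [RHS]eq_bigr do rewrite -sum1_card.
  rewrite (exchange_big_dep (mem P)) /=; last first.
    by move=> e H _; rewrite inE => /andP[].
  apply: eq_bigr => H HP; apply: eq_bigl => e; rewrite inE HP /=.
  by apply: andb_idl; apply/subsetP/SE.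
have upper : \sum_(H in P) #|S H| <= #|F| + k * #|P :\: F|.
  rewrite (big_setID F) /= (setIidPr FP) leq_add //.
    rewrite -sum1_card leq_sum // => H HF; apply/card_le1P => e eH f.
    have [fH|] := boolP (f \in S H); last first.
      by move=> fH; rewrite inE; apply/esym; apply: contraNF fH => /eqP->.
    have [eE ce] := coverF _ _ HF eH; have [fE cf] := coverF _ _ HF fH.
    by rewrite inE; apply/esym/eqP/cov_inj; rewrite // ce cf.
  rewrite mulnC -sum_nat_const leq_sum // => H.
  by rewrite inE => /andP[_ /Sk].
have cardE (p : pred T) : #|[set e in E | p e]| = \sum_(e in E) p e.
  by rewrite -sum1dep_card big_mkcondr.
exists #|F|, #|P :\: F|; split.
- by rewrite cardsD (setIidPr FP) subnKC // subset_leq_card.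
- have: \sum_(e in E) 2 <= \sum_(e in E) (#|cov e| + (#|cov e| == 1)).
    by apply: leq_sum => e /cov_gt0; case: #|cov e| => [|[]].
  rewrite sum_nat_const big_split /= -cardE -/E1; lia.
(* The indicators raise every element to weight three: one covered once lacks two, one covered twice
   lacks one. *)
have: \sum_(e in E) 3 <= \sum_(e in E)
    (#|cov e| + (#|cov e| == 1) + (#|cov e| == 1) + (#|cov e| == 2)).
  by apply: leq_sum => e /cov_gt0; case: #|cov e| => [|[|[]]].
rewrite sum_nat_const !big_split /= -!cardE -/E1 -/E2; lia.
Qed.

(** * Edges and paths of $K_{a,b}$ *)

Definition biclique_edge a b (u : 'I_a * 'I_b) : {set biclique a b} :=
  [set inl u.1; inr u.2].

Lemma biclique_edge_inj a b : injective (@biclique_edge a b).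
Proof.
move=> [i j] [i' j'] /setP eq_e.
have := eq_e (inl i); have := eq_e (inr j); rewrite !inE /= !eqxx /=.
by rewrite orbF => /esym/eqP[->] /esym/eqP[->].
Qed.

Lemma biclique_edgesE a b :
  edges (biclique a b) = [set biclique_edge u | u : 'I_a * 'I_b].
Proof.
apply/setP => e; apply/imsetP/imsetP => [[[[i|j] [i'|j']]]|[[i j] _ ->]].
- by rewrite inE.
- by move=> _ ->; exists (i, j').
- by move=> _ ->; exists (i', j) => //; rewrite /biclique_edge setUC.
- by rewrite inE.
- by exists (inl i, inr j); rewrite ?inE.
Qed.

Lemma card_biclique_edges a b : #|edges (biclique a b)| = a * b.
Proof.
rewrite biclique_edgesE (card_imset _ (@biclique_edge_inj a b)).
by rewrite card_prod !card_ord.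
Qed.

(** The two sides alternate along a path, so the right side can be ahead by one vertex only if the
    path starts there. *)
Lemma biclique_path_count_inr a b (x : biclique a b) p :
  path (@adj (biclique a b)) x p ->
  count (predC (@is_inl 'I_a 'I_b)) (x :: p) <=
    count (@is_inl 'I_a 'I_b) (x :: p) + ~~ is_inl x.
Proof.
elim: p x => [|y p IHp] x /=; first by case: x.
by move=> /andP[xy /IHp /=]; case: x y xy => [i|i] [j|j] //= _; lia.
Qed.

(** At most [a] left vertices allow at most [a + 1] right ones, hence at most [2a + 1] vertices, and
    there is one edge fewer than vertices. *)
Lemma card_biclique_path a b (H : subgraph (biclique a b)) :
  is_path H -> #|edgs H| <= 2 * a.
Proof.
case/is_pathP => -[|x p] [// _ Up Sp] ->; rewrite /edgs /=.
apply: leq_trans (leq_imset_card _ _) _; apply: leq_trans (card_size _) _.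
rewrite size_zip /=.
have := biclique_path_count_inr Sp.
have: count (@is_inl 'I_a 'I_b) (x :: p) <= a.
  rewrite -size_filter -[leqRHS]card_ord -(card_codom (@inl_inj 'I_a 'I_b)).
  rewrite -(card_uniqP (filter_uniq _ Up)) subset_leq_card //.
  apply/subsetP => -[i|j]; rewrite mem_filter //= => _.
  by apply/codomP; exists i.
have /= := count_predC (@is_inl 'I_a 'I_b) (x :: p); lia.
Qed.

Lemma edgs_sub (G : sgraph) (H : subgraph G) :
  is_path H -> edgs H \subset edges G.
Proof.
case/is_pathP => p [_ _ Sp] ->; apply/subsetP => _ /imsetP[[x y] xy ->].
apply/imsetP; exists (x, y) => //; rewrite inE /=.
case: p Sp xy => // z p; elim: p z => //= t p IHp z /andP[zt Sp].
by rewrite inE => /orP[/eqP[-> ->] //|]; apply: IHp Sp.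
Qed.

Lemma ssp_witness (G : sgraph) :
  exists2 P : {set subgraph G}, strongly_separating P & #|P| = ssp G.
Proof.
rewrite /ssp; case: ex_minnP => n /existsP[P /andP[SP /eqP <-]] _; by exists P.
Qed.

Lemma ssp_le (G : sgraph) (P : {set subgraph G}) :
  strongly_separating P -> ssp G <= #|P|.
Proof.
move=> SP; rewrite /ssp; case: ex_minnP => n _; apply.
by apply/existsP; exists P; rewrite SP eqxx.
Qed.

(** * Lower bounds by counting incidences *)

Lemma ssp_biclique_count a b : 1 < a * b ->
  exists t m, [/\ ssp (biclique a b) = t + m, a * b <= a * m + t &
                  6 * (a * b) <= 4 * a * m + m ^ 2 + 6 * t].
Proof.
move=> ab_gt1; have [P /andP[/forall_inP Ppath /forall_inP Psep] <-] :=
  ssp_witness (biclique a b).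
have [|H /Ppath/edgs_sub //|H /Ppath/card_biclique_path //|e f eE fE ef|] :=
  @separating_family_count _ _ (edges (biclique a b)) P (@edgs _) (2 * a).
- by rewrite card_biclique_edges.
- have /andP[/exists_inP[H HP eH] _] :=
    implyP (forall_inP (Psep e eE) f fE) ef.
  by exists H.
rewrite card_biclique_edges => t [m [-> le2 le3]]; exists t, m; split=> //; lia.
Qed.

Lemma ssp_biclique_ge a b : 0 < a -> 1 < a * b -> b <= ssp (biclique a b).
Proof. move=> a_gt0 /ssp_biclique_count[t [m [-> le2 _]]]; nia. Qed.

Lemma ssp_biclique_quadratic a b : 0 < a -> 1 < a * b ->
  6 * (a * b) <= ssp (biclique a b) ^ 2 + 4 * a * ssp (biclique a b).
Proof.
move=> a_gt0 ab_gt1; have [t [m [-> le2 le3]]] := ssp_biclique_count ab_gt1.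
(* Expanding [(t + m)^2 + 4a(t + m)], it suffices that [t^2 + 2tm + 4at >= 6t], which is clear for
   [a >= 2]. *)
rewrite -!mulnn in le3 *; have [a_gt1|a_le1] := ltnP 1 a; first by nia.
have a1 : a = 1 by lia.
(* For [a = 1] this fails only at [t = 1], [m = 0], where [le2] would give [b <= 1]. *)
subst a; case: t le2 le3 => [|[|t]]; case: m => [|m]; nia.
Qed.

(** * Upper bound: zigzag paths over Z/b *)

Lemma edgs_map_iotaP (G : sgraph) (f : nat -> G) n (e : {set G}) :
  reflect (exists2 i, i < n & e = [set f i; f i.+1])
          (e \in edgs (seq_subgraph [seq f i | i <- iota 0 n.+1])).
Proof.
have zipE m : let p := [seq f i | i <- iota m n.+1] in
    zip p (behead p) = [seq (f i, f i.+1) | i <- iota m n].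
  by elim: n m => //= k IHk m; rewrite -IHk.
rewrite /edgs /seq_subgraph zipE; apply: (iffP imsetP) => [[u]|[i lt_in ->]].
  by case/mapP => i; rewrite mem_iota => /andP[_ lt_in] -> ->; exists i.
exists (f i, f i.+1) => //; apply/mapP; exists i => //.
by rewrite mem_iota.
Qed.

Lemma sorted_map_iota (T : Type) (e : rel T) (f : nat -> T) m n :
  (forall i, e (f i) (f i.+1)) -> sorted e [seq f i | i <- iota m n].
Proof.
by move=> ef; case: n => //= n; elim: n m => //= n IHn m; rewrite ef IHn.
Qed.

Section Zigzag.

Local Open Scope ring_scope.

(** The successor forms make ['I_b] the ring Z/b and ['I_a] inhabited, as [inord] requires. *)
Variables a' b' : nat.
Let a := a'.+1.
Let b := b'.+2.
Hypothesis lt_ab : (2 * a < b)%N.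

Definition zig (n : nat) : 'I_b :=
  if odd n then (uphalf n)%:R else - (n./2)%:R.

Lemma natr_Zp_inj (m n : nat) : (m < b)%N -> (n < b)%N ->
  m%:R = n%:R :> 'I_b -> m = n.
Proof.
by move=> mb nb /(congr1 val); rewrite !Zp_nat /= !modn_small.
Qed.

Lemma zigS n : zig n.+1 - zig n = (-1) ^+ odd n * (n.+1)%:R.
Proof.
rewrite /zig oddS; have := odd_double_half n.
case: (odd n) => /= en.
  have -> : uphalf n = n./2.+1 by lia.
  have -> : n.+1 = (n./2.+1 + n./2.+1)%N by lia.
  rewrite natrD; ring.
have -> : n.+1 = (n./2.+1 + n./2)%N by lia.
rewrite natrD; ring.
Qed.

(** Indices of equal parity give equal halves. For opposite parities, equality would make a positive
    sum of at most [a < b] vanish modulo [b]. *)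
Lemma zig_inj m n : (m <= a)%N -> (n <= a)%N -> zig m = zig n -> m = n.
Proof.
wlog: m n / odd n ==> odd m.
  move=> th ma na mn; case: (boolP (odd n ==> odd m)) => [/th|]; first exact.
  rewrite negb_imply => /andP[on om]; apply/esym/th => //.
  by rewrite on implybT.
rewrite /zig; have := odd_double_half m; have := odd_double_half n.
case: (odd m) (odd n) => [] [] //= en em _ ma na.
- by move/natr_Zp_inj; lia.
- by move/eqP; rewrite -subr_eq0 opprK -natrD => /eqP/(@natr_Zp_inj _ 0); lia.
- by move/oppr_inj/natr_Zp_inj; lia.
Qed.

(** Only [n <= 2a] is relevant; for odd such [n], [n./2 < a], so [inord] does not fall back on its
    default. *)
Definition zigzag_vertex (i : 'I_b) (n : nat) : biclique a b :=
  if odd n then inl (inord n./2) else inr (i + zig n./2).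

Definition zigzag (i : 'I_b) : subgraph (biclique a b) :=
  seq_subgraph [seq zigzag_vertex i n | n <- iota 0 (2 * a)%N.+1].

Lemma zigzag_path i : is_path (zigzag i).
Proof.
apply/is_pathP; exists [seq zigzag_vertex i n | n <- iota 0 (2 * a)%N.+1] => //.
split=> //.
  rewrite map_inj_in_uniq ?iota_uniq // => m n; rewrite !mem_iota /= => mb nb.
  have := odd_double_half m; have := odd_double_half n; rewrite /zigzag_vertex.
  case: (odd m) (odd n) => [] [] //= en em.
  - by move=> E; have := congr1 val (inl_inj E); rewrite /= !inordK; lia.
  - by move=> E; have := zig_inj _ _ (addrI i (inr_inj E)); lia.
by apply: sorted_map_iota => n; rewrite /zigzag_vertex /=; case: odd.
Qed.

(** The left vertex [j] sits at position [2j + 1], between the right vertices [i + zig j] and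
    [i + zig j.+1]. *)
Lemma zigzag_edge i u :
  (biclique_edge u \in edgs (zigzag i)) =
  (u.2 == i + zig u.1) || (u.2 == i + zig u.1.+1).
Proof.
case: u => j k; rewrite /zigzag -[(j, k).1]/j -[(j, k).2]/k.
have evenv m : zigzag_vertex i m.*2 = inr (i + zig m).
  by rewrite /zigzag_vertex odd_double doubleK.
have oddv m : zigzag_vertex i m.*2.+1 = inl (inord m).
  by rewrite /zigzag_vertex /= odd_double /= uphalf_double.
have edge_even (m : nat) : [set zigzag_vertex i m.*2; zigzag_vertex i m.*2.+1]
    = biclique_edge (inord m : 'I_a, i + zig m).
  by rewrite evenv oddv setUC.
have edge_odd (m : nat) :
    [set zigzag_vertex i m.*2.+1; zigzag_vertex i m.*2.+2]
    = biclique_edge (inord m : 'I_a, i + zig m.+1).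
  by rewrite -doubleS evenv oddv.
apply/edgs_map_iotaP/orP => [[n lt_n]|].
  have := odd_double_half n; case: (odd n) => /= en; rewrite -en.
    rewrite edge_odd => /biclique_edge_inj[-> ->]; right.
    by rewrite inordK ?eqxx //; lia.
  rewrite edge_even => /biclique_edge_inj[-> ->]; left.
  by rewrite inordK ?eqxx //; lia.
have ja := ltn_ord j.
case=> /eqP ->; [exists j.*2 | exists j.*2.+1]; try lia.
  by rewrite edge_even inord_val.
by rewrite edge_odd inord_val.
Qed.

(** Both absolute values are at most [a]. With opposite signs, equality would make their sum,
    positive and at most [2a < b], vanish modulo [b]. *)
Lemma sign_natr_inj (s t : bool) (m n : nat) : (m < a)%N -> (n < a)%N ->
  (-1) ^+ s * (m.+1)%:R = (-1) ^+ t * (n.+1)%:R :> 'I_b -> m = n /\ s = t.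
Proof.
have opp_natr (i j : nat) : (i < a)%N -> (j < a)%N ->
    - (i.+1)%:R <> (j.+1)%:R :> 'I_b.
  move=> ia ja /eqP; rewrite eq_sym -subr_eq0 opprK -natrD => /eqP.
  by move/(@natr_Zp_inj _ 0); lia.
move=> ma na; case: s t => [] []; rewrite !(expr0, expr1, mulN1r, mul1r).
- by move/oppr_inj/natr_Zp_inj; lia.
- by move/(opp_natr _ _ ma na).
- by move/esym/(opp_natr _ _ na ma).
- by move/natr_Zp_inj; lia.
Qed.

Lemma zigzag_separates u v : u != v ->
  exists i, (biclique_edge u \in edgs (zigzag i)) &&
            (biclique_edge v \notin edgs (zigzag i)).
Proof.
move=> uv; apply/existsP; apply: contraNT uv => /existsPn sub.
case: u v sub => [j k] [j' k'] sub.
have {}sub i : biclique_edge (j, k) \in edgs (zigzag i) ->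
     biclique_edge (j', k') \in edgs (zigzag i).
  by move=> ki; have := sub i; rewrite ki negbK.
have ja := ltn_ord j; have ja' := ltn_ord j'.
have zigSj : zig j.+1 <> zig j by move/zig_inj; lia.
(* These are the two zigzags through the first edge, so the second edge lies on both of them. *)
have := sub (k - zig j); have := sub (k - zig j.+1).
rewrite !zigzag_edge /= !subrK !eqxx orbT.
(* If the second edge is at the same step of both zigzags, then [zig j = zig j.+1]. Otherwise its
   two steps differ, and the increments of [zig] at [j] and [j'] agree up to sign: opposite
   increments force [j = j'] with contradictory parities, equal ones force the edges to coincide. *)
move=> /(_ isT)/orP[] /eqP kS /(_ isT)/orP[] /eqP k0.
- by case: zigSj; move: kS; rewrite k0 => /addIr/addrI/oppr_inj.
- have : zig j.+1 - zig j = - (zig j'.+1 - zig j').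
    by transitivity (k' - zig j'.+1 - (k - zig j.+1));
      [rewrite k0 | rewrite kS]; ring.
  rewrite !zigS -mulNr -signrN => /sign_natr_inj[] // ->; by case: odd.
- have : zig j.+1 - zig j = zig j'.+1 - zig j'.
    by transitivity (k' - zig j' - (k - zig j.+1));
      [rewrite k0 | rewrite kS]; ring.
  rewrite !zigS => /sign_natr_inj[] // /val_inj jj' _.
  by rewrite k0 jj' subrK.
- by case: zigSj; move: kS; rewrite k0 => /addIr/addrI/oppr_inj.
Qed.

Lemma ssp_biclique_le : (ssp (biclique a b) <= b)%N.
Proof.
apply: leq_trans (_ : (#|zigzag @: 'I_b| <= b)%N); last first.
  by rewrite -[leqRHS]card_ord leq_imset_card.
apply: ssp_le; apply/andP; split.
  by apply/forall_inP => _ /imsetP[i _ ->]; apply: zigzag_path.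
apply/forall_inP => e; rewrite biclique_edgesE => /imsetP[u _ ->].
apply/forall_inP => f /imsetP[v _ ->].
apply/implyP => uv; have {}uv: u != v by apply: contraNneq uv => ->.
have sep x y : x != y -> [exists H in zigzag @: 'I_b,
    (biclique_edge x \in edgs H) && (biclique_edge y \notin edgs H)].
  case/zigzag_separates => i xy; apply/exists_inP.
  by exists (zigzag i); rewrite ?imset_f.
by rewrite /separates !sep // eq_sym.
Qed.

End Zigzag.

Local Open Scope ring_scope.

(* ssp (biclique 1 1) = 0, so the bound in (ii) fails for a = b = 1; the
   hypothesis (a, b) <> (1, 1) excludes exactly this case. *)
Theorem theorem4p1 (R : rcfType) (a b : nat)
    (ha : (0 < a)%N) (hb : (0 < b)%N) (hab : (a <= b)%N) :
  ((a%:R : R) < b%:R / 2 -> ssp (biclique a b) = b) /\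
  ((a%:R : R) >= b%:R / 2 -> (a, b) <> (1%N, 1%N) ->
     (Num.sqrt (6 * (b%:R / a%:R) + 4) - 2) * a%:R
       <= ((ssp (biclique a b))%:R : R)).
Proof.
split=> [|_ ab_neq11].
  rewrite ltr_pdivlMr // -natrM ltr_nat mulnC => lt2ab.
  case: a b ha lt2ab {hb hab} => [|a] [|[|b]] // _ lt2ab; try lia.
  apply/eqP; rewrite eqn_leq ssp_biclique_le //= ssp_biclique_ge //; lia.
have ab_gt1 : (1 < a * b)%N.
  case: a b ha hb hab ab_neq11 => [|[|a]] [|[|b]] //; lia.
have := ssp_biclique_quadratic ha ab_gt1; set n := ssp _.
rewrite -(ler_nat R) natrD natrX !natrM => quad.
have a_gt0 : 0 < a%:R :> R by rewrite ltr0n.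
have n_ge0 : 0 <= n%:R / a%:R :> R by rewrite divr_ge0.
(* Dividing by [a] and squaring reduces the claim to [6b/a + 4 <= (n/a + 2)^2]; multiplied by [a^2],
   this is [quad] with [4a^2] added to both sides. *)
rewrite -ler_pdivlMr // lerBlDr -[leRHS]ger0_norm ?addr_ge0 // -sqrtr_sqr.
rewrite ler_wsqrtr // -(ler_pM2r (exprn_gt0 2 a_gt0)).
have -> : (6 * (b%:R / a%:R) + 4) * a%:R ^+ 2
    = 6 * (a%:R * b%:R) + 4 * a%:R ^+ 2 :> R.
  by field; rewrite gt_eqF.
have -> : (n%:R / a%:R + 2) ^+ 2 * a%:R ^+ 2
    = n%:R ^+ 2 + 4 * a%:R * n%:R + 4 * a%:R ^+ 2 :> R.
  by field; rewrite gt_eqF.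
by rewrite lerD2r.
Qed.
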